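(* For all integers $n\geq 3$ and every $\lambda>-\frac{1}{2}$, the best constant $c_n(\lambda)$ in the Markov inequality $$\Vert p'\Vert_{w_\lambda}\leq c_n(\lambda)\,\Vert p\Vert_{w_\lambda},\qquad p\in\mathcal{P}_n,$$ satisfies $$\frac{(n+1)\big(n+\lambda+\frac{1}{2}\big)^2(n+2\lambda)}{(2\lambda+1)(2\lambda+5)}\leq c_n^2(\lambda)\leq\frac{\big(n+\frac{5}{4}\lambda+\frac{9}{8}\big)^4}{2(2\lambda+1)\sqrt{2\lambda+5}}.$$
   Context: $\mathcal{P}_n$ denotes the class of real algebraic polynomials of degree at most $n$. For $\lambda>-1/2$, $w_\lambda(t)=(1-t^2)^{\lambda-1/2}$ on $(-1,1)$ is the Gegenbauer weight and $\Vert f\Vert_{w_\lambda}=\big(\int_{-1}^1 w_\lambda(t)f^2(t)\,dt\big)^{1/2}$. The best Markov constant is $c_n(\lambda)=\sup\{\Vert p'\Vert_{w_\lambda}/\Vert p\Vert_{w_\lambda}: p\in\mathcal{P}_n,\ p\neq 0\}$. *)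

(* Defs.v *)
From HB Require Import structures.
From mathcomp Require Import all_boot all_order all_algebra.
From mathcomp Require Import all_classical all_reals all_analysis.
Set Implicit Arguments. Unset Strict Implicit. Unset Printing Implicit Defensive.
Import Order.TTheory GRing.Theory Num.Theory.
Import numFieldNormedType.Exports.
Local Open Scope classical_set_scope.
Local Open Scope ring_scope.

Definition gweight {R : realType} (lam : R) (t : R) : R :=
  powR (1 - t ^+ 2) (lam - 2^-1).

Definition gnorm {R : realType} (lam : R) (f : R -> R) : R :=
  Num.sqrt (Rintegral (@lebesgue_measure R) `]-1, 1[
                      (fun t => gweight lam t * f t ^+ 2)).

Definition polys_le {R : realType} (n : nat) : set {poly R} :=
  [set p | (size p <= n.+1)%N].

Definition markov_const {R : realType} (n : nat) (lam : R) : \bar R :=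
  ereal_sup [set ((gnorm lam (fun t => (p^`()).[t]) /
                   gnorm lam (fun t => p.[t]))%:E)%E
            | p in [set p | polys_le n p /\ p != 0]].

(* Main.v *)
Require Import Defs.
From HB Require Import structures.
From mathcomp Require Import all_boot all_order all_algebra.
From mathcomp Require Import all_classical all_reals all_analysis.
From mathcomp Require Import measurable_realfun ring lra.
Set Implicit Arguments.
Unset Strict Implicit.
Unset Printing Implicit Defensive.
Import Order.TTheory GRing.Theory Num.Theory.
Import numFieldNormedType.Exports.
Local Open Scope classical_set_scope.
Local Open Scope ring_scope.

(** Integrating by parts against the weight [w_lam] shows that the Gegenbauer
    polynomials [e_k] are orthogonal and that [e_(k+2)' = e_k' + c_k e_(k+1)].
    Hence [<e_k', e_l'>] is [|e_k'|^2] for [k <= l] of the same parity and [0]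
    for [k], [l] of different parities, while
    [|e_k'|^2 / |e_k|^2 = 2 k (k + lam) (k + 2 lam) / (2 lam + 1)].  The squared
    Markov constant of degree [n] is thus the largest eigenvalue of two explicit
    positive semidefinite matrices [M], one for each parity class, and such an
    eigenvalue lies between [tr (M^2) / tr M] and [sqrt (tr (M^2))].  When [n] grows by
    two, both traces of the class of [n] grow by rational functions of [n] and
    [lam], so that both bounds follow by induction from polynomial
    inequalities. *)

(** * Quadratic forms relative to a diagonal form *)

Lemma quadratic_ge0_discr (R : realFieldType) (a b c : R) : 0 <= a ->
  (forall t, 0 <= a * t ^+ 2 + 2 * b * t + c) -> b ^+ 2 <= a * c.
Proof.
move=> a_ge0 q_ge0; pose q := Poly [:: c; 2 * b; a].
have := @deg_le2_poly_delta_ge0 R q (size_Poly _).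
rewrite !coefE /= => /(_ a_ge0) discr_le0; rewrite -subr_le0.
suff : (2 * b) ^+ 2 - 4 * a * c <= 0 by lra.
apply: discr_le0 => t; rewrite horner_Poly /=.
by have := q_ge0 t; lra.
Qed.

Lemma weighted_cauchy_schwarz (R : realFieldType) (I : Type) (r : seq I)
    (w u v : I -> R) : (forall i, 0 < w i) ->
  (\sum_(i <- r) u i * v i) ^+ 2 <=
  (\sum_(i <- r) u i ^+ 2 / w i) * (\sum_(i <- r) v i ^+ 2 * w i).
Proof.
move=> w_gt0; apply: quadratic_ge0_discr => [|t].
  by apply: sumr_ge0 => i _; rewrite divr_ge0 ?sqr_ge0 ?ltW.
rewrite mulr_suml mulrAC mulr_sumr -!big_split /=.
apply: sumr_ge0 => i _; have w_neq0 := lt0r_neq0 (w_gt0 i).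
rewrite (_ : _ + _ = (u i * t + v i * w i) ^+ 2 / w i); last by field.
by rewrite divr_ge0 ?sqr_ge0 ?ltW.
Qed.

Section quadratic_pencil.
Variables (R : realFieldType) (T : Type) (A : T -> T -> R) (h : T -> R).
Implicit Types (s : seq T) (x : T -> R) (i j m : T).

Definition quad_form s x := \sum_(i <- s) \sum_(j <- s) x i * x j * A i j.

Definition diag_form s x := \sum_(i <- s) x i ^+ 2 * h i.

(* The traces of [M] and [M ^ 2], where [M i j = A i j / sqrt (h i * h j)] has
   the eigenvalues of the form [A] relative to the diagonal form [h]. *)
Definition pencil_trace s := \sum_(i <- s) A i i / h i.

Definition pencil_trace_sqr s :=
  \sum_(i <- s) \sum_(j <- s) A i j ^+ 2 / (h i * h j).

Hypothesis h_gt0 : forall i, 0 < h i.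

Let h_neq0 i : h i != 0. Proof. exact: lt0r_neq0. Qed.

Lemma diag_form_ge0 s x : 0 <= diag_form s x.
Proof. by apply: sumr_ge0 => i _; rewrite mulr_ge0 ?sqr_ge0 ?ltW. Qed.

Lemma quad_form_sqr_le s x :
  quad_form s x ^+ 2 <= pencil_trace_sqr s * diag_form s x ^+ 2.
Proof.
pose r i := \sum_(j <- s) A i j * x j.
have row_le i : r i ^+ 2 / h i <=
    (\sum_(j <- s) A i j ^+ 2 / (h i * h j)) * diag_form s x.
  rewrite ler_pdivrMr // mulrAC mulr_suml.
  apply: (le_trans (weighted_cauchy_schwarz s (A i) x h_gt0)).
  rewrite ler_wpM2r ?diag_form_ge0 // le_eqVlt; apply/predU1l.
  by apply: eq_bigr => j _; field; rewrite !h_neq0.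
have -> : quad_form s x = \sum_(i <- s) r i * x i.
  apply: eq_bigr => i _; rewrite mulr_suml.
  by apply: eq_bigr => j _; ring.
apply: (le_trans (weighted_cauchy_schwarz s r x h_gt0)).
rewrite expr2 mulrA ler_wpM2r ?diag_form_ge0 // mulr_suml.
by apply: ler_sum => i _; exact: row_le.
Qed.

Lemma quad_form_le s x B : 0 <= B -> pencil_trace_sqr s <= B ^+ 2 ->
  quad_form s x <= B * diag_form s x.
Proof.
move=> B_ge0 trace_le; have BD_ge0 : 0 <= B * diag_form s x.
  by rewrite mulr_ge0 ?diag_form_ge0.
have [quad_le0|/ltW quad_ge0] := leP (quad_form s x) 0.
  exact: le_trans quad_le0 BD_ge0.
rewrite -ler_sqr ?nnegrE // exprMn (le_trans (quad_form_sqr_le s x)) //.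
by rewrite ler_wpM2r ?sqr_ge0.
Qed.

Lemma pencil_trace_sqr_ge0 s : 0 <= pencil_trace_sqr s.
Proof.
apply: sumr_ge0 => i _; apply: sumr_ge0 => j _.
by rewrite divr_ge0 ?sqr_ge0 // mulr_ge0 ?ltW.
Qed.

Lemma pencil_trace_sqr_rcons s m : (forall i j, A i j = A j i) ->
  pencil_trace_sqr (rcons s m) = pencil_trace_sqr s +
    2 * (\sum_(i <- s) A i m ^+ 2 / h i) / h m + (A m m / h m) ^+ 2.
Proof.
move=> A_sym; rewrite /pencil_trace_sqr big_rcons /=.
under eq_bigr do rewrite big_rcons /=.
rewrite big_split /= big_rcons /=.
have col_sum : \sum_(i <- s) A i m ^+ 2 / (h i * h m) =
    (\sum_(i <- s) A i m ^+ 2 / h i) / h m.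
  by rewrite mulr_suml; apply: eq_bigr => i _; rewrite invfM mulrA.
have row_sum : \sum_(i <- s) A m i ^+ 2 / (h m * h i) =
    (\sum_(i <- s) A i m ^+ 2 / h i) / h m.
  by rewrite -col_sum; apply: eq_bigr => i _; rewrite A_sym [h m * _]mulrC.
rewrite row_sum col_sum; field; exact: h_neq0.
Qed.

(* Each column [A i j / h i] of the matrix is tested in the form. *)
Lemma pencil_trace_sqr_le s C : 0 <= C -> (forall j, 0 <= A j j) ->
  (forall x j, (\sum_(i <- s) x i * A i j) ^+ 2 <= quad_form s x * A j j) ->
  (forall x, quad_form s x <= C * diag_form s x) ->
  pencil_trace_sqr s <= C * pencil_trace s.
Proof.
move=> C_ge0 A_ge0 A_cauchy A_le.
rewrite /pencil_trace_sqr exchange_big mulr_sumr.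
apply: ler_sum => j _; pose x i := A i j / h i.
have col_sum : \sum_(i <- s) A i j ^+ 2 / (h i * h j) = diag_form s x / h j.
  rewrite mulr_suml; apply: eq_bigr => i _; rewrite /x; field.
  by rewrite !h_neq0.
rewrite col_sum mulrA ler_pM2r ?invr_gt0 //.
have [|diag_gt0] := leP (diag_form s x) 0.
  by move=> /le_trans; apply; rewrite mulr_ge0.
rewrite -(ler_pM2l diag_gt0) -expr2.
have xA : \sum_(i <- s) x i * A i j = diag_form s x.
  by apply: eq_bigr => i _; rewrite /x; field; exact: h_neq0.
rewrite -{1}xA (le_trans (A_cauchy x j)) // mulrA [_ * C]mulrC.
by rewrite ler_wpM2r.
Qed.

End quadratic_pencil.

(** * Increments of the traces and of the bounds *)

Lemma nat_ind2 (P : nat -> Prop) : P 0%N -> P 1%N ->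
  (forall n, P n -> P n.+1 -> P n.+2) -> forall n, P n.
Proof.
move=> P0 P1 PSS n; suff : P n /\ P n.+1 by case.
by elim: n => [|n [Pn PSn]]; split=> //; exact: PSS.
Qed.

Lemma monomial_ge0 (R : realDomainType) (s u : R) : 0 <= s -> 0 <= u ->
  forall i j, 0 <= s ^+ i * u ^+ j.
Proof. by move=> s_ge0 u_ge0 i j; rewrite mulr_ge0 ?exprn_ge0. Qed.

Ltac pose_monomials_row mono i j :=
  let mono_ij := fresh in have mono_ij := mono i j;
  match j with S ?j' => pose_monomials_row mono i j' | O => idtac end.

Ltac pose_monomials mono i j :=
  pose_monomials_row mono i j;
  match i with S ?i' => pose_monomials mono i' j | O => idtac end.

(* Proves the nonnegativity of a polynomial in [s, u >= 0], of degree at most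
   [i] in [s] and [j] in [u], all of whose coefficients are nonnegative. *)
Ltac nonneg_coefs s_ge0 u_ge0 i j :=
  pose_monomials (monomial_ge0 s_ge0 u_ge0) i j; lra.

Section rational_functions.
Variables (R : realFieldType) (lam : R).
Implicit Type k : R.

(* For an orthogonal basis [e_k] of Gegenbauer polynomials, [deriv_ratio k] will
   be [|e_k'|^2 / |e_k|^2], [deriv_ratio_sum k * |e_k|^2] the sum of
   [|e_j'|^4 / |e_j|^2] over the [j <= k] of the parity of [k], and
   [trace_sqr_incr k] the increment of [tr (M^2)] from [k - 2] to [k]. *)
Definition deriv_ratio k := 2 * k * (k + lam) * (k + 2 * lam) / (2 * lam + 1).

Definition deriv_ratio_sum k :=
  2 * k * (k + lam) * (k + 2 * lam) * (k + 2 * lam + 1) * (k + 2 * lam + 2) *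
  (k * (k + 2 * lam + 2) - 4 / (2 * lam + 3)) /
  ((2 * lam + 1) ^+ 2 * (2 * lam + 5)).

Definition trace_sqr_incr k := 2 * deriv_ratio_sum k - deriv_ratio k ^+ 2.

Definition denominator :=
  4 * (2 * lam + 1) ^+ 2 * (2 * lam + 3) * (2 * lam + 5).

Definition trace_sqr_incr_num k := k * (k + lam) * (k + 2 * lam) *
  ((k + 2 * lam + 1) * (k + 2 * lam + 2) *
     (k * (k + 2 * lam + 2) * (2 * lam + 3) - 4) -
   (2 * lam + 5) * (2 * lam + 3) * k * (k + lam) * (k + 2 * lam)).

(* [tr M] for the class of [k] is this fraction with [4 lam ^ 2] ([k] even) or
   [1] ([k] odd) subtracted from its numerator. *)
Definition trace_bound k :=
  ((k + 1) * (k + 2 * lam + 1) - 1) ^+ 2 / (4 * (2 * lam + 1)).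

Definition markov_upper_sqr k :=
  (k + 5 / 4 * lam + 9 / 8) ^+ 8 / (4 * (2 * lam + 1) ^+ 2 * (2 * lam + 5)).

Definition markov_lower_num k :=
  (k + 1) * (k + lam + 2^-1) ^+ 2 * (k + 2 * lam).

Definition markov_lower k :=
  markov_lower_num k / ((2 * lam + 1) * (2 * lam + 5)).

Hypothesis lam_gt : - 2^-1 < lam.

(* [lra] does not use section hypotheses. *)
Let lam1_gt0 : 0 < 2 * lam + 1. Proof. by have := lam_gt; lra. Qed.
Let lam3_gt0 : 0 < 2 * lam + 3. Proof. by have := lam_gt; lra. Qed.
Let lam5_gt0 : 0 < 2 * lam + 5. Proof. by have := lam_gt; lra. Qed.
Let lam1_neq0 : 2 * lam + 1 != 0. Proof. exact: lt0r_neq0 lam1_gt0. Qed.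
Let lam3_neq0 : 2 * lam + 3 != 0. Proof. exact: lt0r_neq0 lam3_gt0. Qed.
Let lam5_neq0 : 2 * lam + 5 != 0. Proof. exact: lt0r_neq0 lam5_gt0. Qed.

Let denominator_gt0 : 0 < denominator.
Proof. by rewrite !mulr_gt0 ?exprn_gt0. Qed.

Let lam_shift : exists2 u : R, 0 <= u & lam = u - 2^-1.
Proof. by exists (lam + 2^-1); have := lam_gt; lra. Qed.

Lemma trace_sqr_incrE k : trace_sqr_incr k =
  16 * trace_sqr_incr_num k / denominator.
Proof.
rewrite /trace_sqr_incr /deriv_ratio_sum /deriv_ratio /trace_sqr_incr_num.
by rewrite /denominator; field; rewrite lam1_neq0 lam3_neq0 lam5_neq0.
Qed.

(* The right-hand side comes from
   [(y + 1)^8 - (y - 1)^8 = 16 y (y^6 + 7 y^4 + 7 y^2 + 1)]. *)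
Lemma trace_sqr_incr_num_le k : 1 <= k -> let y := k + 5 / 4 * lam + 1 / 8 in
  trace_sqr_incr_num k <=
  y * (y ^+ 6 + 7 * y ^+ 4 + 7 * y ^+ 2 + 1) * (2 * lam + 3).
Proof.
move=> k_ge1 /=; rewrite /trace_sqr_incr_num -subr_ge0.
have [s s_ge0 ->] : exists2 s : R, 0 <= s & k = s + 1 by exists (k - 1); lra.
have [u u_ge0 ->] := lam_shift.
nonneg_coefs s_ge0 u_ge0 6%N 8%N.
Qed.

Lemma trace_sqr_incr_le k : 1 <= k ->
  trace_sqr_incr k <= markov_upper_sqr k - markov_upper_sqr (k - 2).
Proof.
move=> k_ge1; rewrite -subr_ge0 trace_sqr_incrE.
have := trace_sqr_incr_num_le k_ge1.
set y := k + _ + _ => /= incr_num_le.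
have -> : markov_upper_sqr k - markov_upper_sqr (k - 2) -
    16 * trace_sqr_incr_num k / denominator =
    16 * (y * (y ^+ 6 + 7 * y ^+ 4 + 7 * y ^+ 2 + 1) * (2 * lam + 3) -
          trace_sqr_incr_num k) / denominator.
  rewrite /markov_upper_sqr /y /denominator; field.
  by rewrite lam1_neq0 lam3_neq0 lam5_neq0.
by rewrite divr_ge0 ?mulr_ge0 ?subr_ge0 // ltW ?denominator_gt0.
Qed.

Lemma le_markov_upper_sqr j k : 0 <= j -> j <= k ->
  markov_upper_sqr j <= markov_upper_sqr k.
Proof.
move=> j_ge0 j_le_k; have lam_gt' := lam_gt.
rewrite ler_pM2r ?invr_gt0 ?mulr_gt0 ?exprn_gt0 //.
by rewrite lerXn2r ?nnegrE; lra.
Qed.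

Lemma trace_boundB k : trace_bound k - trace_bound (k - 2) = deriv_ratio k.
Proof. by rewrite /trace_bound /deriv_ratio; field. Qed.

Lemma trace_bound_ge0 k : 0 <= trace_bound k.
Proof. by rewrite divr_ge0 ?sqr_ge0 // mulr_ge0 // ltW. Qed.

Definition lower_trace_num k :=
  markov_lower_num k * ((k + 1) * (k + 2 * lam + 1) - 1) ^+ 2 * (2 * lam + 3).

Lemma markov_lower_trace_boundE k : markov_lower k * trace_bound k =
  lower_trace_num k / denominator.
Proof.
rewrite /markov_lower /trace_bound /lower_trace_num /denominator; field.
by rewrite lam1_neq0 lam3_neq0 lam5_neq0.
Qed.

Lemma markov_lower_step k : 2 <= k ->
  markov_lower k * trace_bound k <=
  markov_lower (k - 2) * trace_bound (k - 2) + trace_sqr_incr k.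
Proof.
move=> k_ge2; have num_le : lower_trace_num k <=
    lower_trace_num (k - 2) + 16 * trace_sqr_incr_num k.
  rewrite /lower_trace_num /markov_lower_num /trace_sqr_incr_num -subr_ge0.
  have [s s_ge0 ->] : exists2 s : R, 0 <= s & k = s + 2 by exists (k - 2); lra.
  have [u u_ge0 ->] := lam_shift; nonneg_coefs s_ge0 u_ge0 6%N 6%N.
rewrite !markov_lower_trace_boundE trace_sqr_incrE.
by rewrite -mulrDl ler_pM2r ?invr_gt0 ?denominator_gt0.
Qed.

Lemma markov_lower_base k : k = 2 \/ k = 3 ->
  markov_lower k * trace_bound k <= trace_sqr_incr k.
Proof.
move=> k23; have num_le : lower_trace_num k <= 16 * trace_sqr_incr_num k.
  rewrite /lower_trace_num /markov_lower_num /trace_sqr_incr_num.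
  have [u u_ge0 ->] := lam_shift.
  by case: k23 => ->; nonneg_coefs u_ge0 u_ge0 0%N 6%N.
rewrite markov_lower_trace_boundE trace_sqr_incrE.
by rewrite ler_pM2r ?invr_gt0 ?denominator_gt0.
Qed.

End rational_functions.

(** * Gegenbauer polynomials *)

Lemma poly_span (F : fieldType) (u : nat -> {poly F}) :
  (forall k, size (u k) = k.+1) ->
  forall n (p : {poly F}), (size p <= n)%N ->
  exists c : nat -> F, p = \sum_(0 <= k < n) c k *: u k.
Proof.
move=> size_u; elim=> [|n IH] p.
  rewrite leqn0 size_poly_eq0 => /eqP ->.
  by exists (fun=> 0); rewrite big_geq.
have leadE : lead_coef (u n) = (u n)`_n by rewrite lead_coefE size_u.
have lead_neq0 : lead_coef (u n) != 0.
  by rewrite lead_coef_eq0 -size_poly_eq0 size_u.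
move=> size_p; pose a := p`_n / lead_coef (u n).
have [|c cE] := IH (p - a *: u n).
  apply/leq_sizeP => j; rewrite coefB coefZ leq_eqVlt => /predU1P[<-|nj].
    by rewrite -[(u n)`_n]leadE divfK ?subrr.
  by rewrite !nth_default ?mulr0 ?subr0 ?size_u // (leq_trans size_p).
exists (fun k => if k == n then a else c k).
rewrite big_nat_recr //= eqxx -[LHS](subrK (a *: u n)) cE; congr (_ + _).
by apply: eq_big_nat => i /andP[_ i_lt_n]; rewrite ltn_eqF.
Qed.

Definition parity_class n := [seq k <- iota 0 n.+1 | odd k == odd n].

Lemma mem_parity_class n k :
  (k \in parity_class n) = (k <= n)%N && (odd k == odd n).
Proof. by rewrite mem_filter mem_iota add0n ltnS andbC. Qed.

Lemma parity_class_uniq n : uniq (parity_class n).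
Proof. by rewrite filter_uniq ?iota_uniq. Qed.

Lemma parity_classS n : parity_class n.+2 = rcons (parity_class n) n.+2.
Proof.
rewrite /parity_class -(addn2 n.+1) iotaD filter_cat /= negbK eqxx.
by case: (odd n); rewrite /= cats1.
Qed.

Lemma parity_class_small n : (n < 2)%N -> parity_class n = [:: n].
Proof. by case: n => [|[|]]. Qed.

Lemma sum_parity_class (V : nmodType) (f : nat -> V) n :
  \sum_(0 <= k < n.+2) f k =
  \sum_(k <- parity_class n.+1) f k + \sum_(k <- parity_class n) f k.
Proof.
elim: n => [|n IH]; first by rewrite big_nat_recr //= big_nat1 !big_seq1 addrC.
by rewrite big_nat_recr //= IH parity_classS big_rcons /= -addrA addrC.
Qed.

Section gegenbauer.
Variables (R : realFieldType) (lam : R).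

(* [geg k] is the classical [C_k / (2 lam)] for [k >= 1] and [geg 0 = 1], which
   makes sense at [lam = 0] at the price of the exceptional [geg_coef 0]. *)
Definition geg_coef k : R := if k is 0 then 1 else k%:R + 2 * lam.

Fixpoint geg_fix k : {poly R} :=
  if k is j.+1 then
    j.+1%:R^-1 *:
      (geg_coef j *: ('X * geg_fix j) - (1 - 'X^2) * (geg_fix j)^`())
  else 1.

Definition geg := locked geg_fix.

Lemma geg0 : geg 0 = 1.
Proof. by rewrite /geg -lock. Qed.

Lemma geg_raising k : k.+1%:R *: geg k.+1 =
  geg_coef k *: ('X * geg k) - (1 - 'X^2) * (geg k)^`().
Proof. by rewrite /geg -lock /= scalerA divff ?scale1r // pnatr_eq0. Qed.

Lemma geg1 : geg 1 = 'X.
Proof.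
by have := geg_raising 0; rewrite geg0 derivC mulr1 mulr0 subr0 !scale1r.
Qed.

Lemma geg_coef_deriv k :
  geg_coef k *: (geg k)^`() = (k%:R + 2 * lam) *: (geg k)^`().
Proof. by case: k => [|k] //; rewrite geg0 derivC !scaler0. Qed.

(* [w_lam * weighted_deriv q] is the derivative of [w_(lam + 1) * q]. *)
Definition weighted_deriv (q : {poly R}) :=
  (1 - 'X^2) * q^`() - (2 * lam + 1) *: ('X * q).

Definition geg_op (p : {poly R}) := weighted_deriv p^`().

Definition geg_eigenvalue k := k%:R * (k%:R + 2 * lam).

Lemma deriv_geg_of_ode k : geg_op (geg k) = - geg_eigenvalue k *: geg k ->
  (geg k.+1)^`() = 'X * (geg k)^`() + geg_coef k *: geg k.
Proof.
case: k => [_|k ode].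
  by rewrite geg1 derivX geg0 derivC mulr0 add0r scale1r.
have nz : k.+2%:R != 0 :> R by rewrite pnatr_eq0.
apply: (scalerI nz); rewrite -derivZ geg_raising.
rewrite derivB derivZ !derivM derivB derivC derivX derivXn [geg_coef _]/=.
have -> : (1 - 'X^2) * (geg k.+1)^`()^`() =
    (2 * lam + 1) *: ('X * (geg k.+1)^`()) - geg_eigenvalue k.+1 *: geg k.+1.
  by rewrite -scaleNr -ode /geg_op /weighted_deriv [RHS]addrC subrK.
rewrite /geg_eigenvalue; move: (geg k.+1) (geg k.+1)^`() => e e'.
by rewrite -!mul_polyC; ring.
Qed.

(* The raising relation and [e_(k+1)' = X e_k' + c_k e_k] eliminate [e_k']. *)
Lemma geg_lowering_of_deriv k :
  (geg k.+1)^`() = 'X * (geg k)^`() + geg_coef k *: geg k ->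
  (1 - 'X^2) * (geg k.+1)^`() =
  geg_coef k *: geg k - k.+1%:R *: ('X * geg k.+1).
Proof.
by move=> ->; rewrite scalerAr geg_raising -!mul_polyC; ring.
Qed.

Lemma geg_ode k : geg_op (geg k) = - geg_eigenvalue k *: geg k.
Proof.
elim: k => [|k ode].
  rewrite /geg_op /weighted_deriv /geg_eigenvalue geg0 derivC deriv0.
  by rewrite !(mulr0, mul0r, oppr0, scale0r, scaler0, subr0).
have derivE := deriv_geg_of_ode ode.
have derivXE : (geg k)^`() = 'X * (geg k.+1)^`() - k.+1%:R *: geg k.+1.
  by rewrite derivE geg_raising -!mul_polyC; ring.
move: derivXE (geg_lowering_of_deriv derivE); rewrite /geg_op /weighted_deriv.
move: (geg k.+1) => e derivXE /(congr1 (@deriv R)).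
rewrite derivM !derivB !derivZ derivC derivXn derivM derivX geg_coef_deriv.
rewrite derivXE /geg_eigenvalue => /(canRL (addKr _)) ->.
by rewrite -!mul_polyC; ring.
Qed.

Lemma deriv_geg k : (geg k.+1)^`() = 'X * (geg k)^`() + geg_coef k *: geg k.
Proof. exact/deriv_geg_of_ode/geg_ode. Qed.

Lemma deriv_gegSS k :
  (geg k.+2)^`() = (geg k)^`() + (2 * (k.+1%:R + lam)) *: geg k.+1.
Proof.
have XderivE : 'X * (geg k.+1)^`() = (geg k)^`() + k.+1%:R *: geg k.+1.
  by rewrite deriv_geg geg_raising -!mul_polyC; ring.
by rewrite deriv_geg XderivE /geg_coef -!mul_polyC; ring.
Qed.

Lemma geg_rec k : k.+2%:R *: geg k.+2 =
  (2 * (k.+1%:R + lam)) *: ('X * geg k.+1) - geg_coef k *: geg k.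
Proof.
rewrite geg_raising (geg_lowering_of_deriv (deriv_geg k)) [geg_coef k.+1]/=.
by rewrite -!mul_polyC; ring.
Qed.

Hypothesis lam_gt : - 2^-1 < lam.

Lemma natrS_lam_gt0 k : 0 < k.+1%:R + lam.
Proof. by have := lam_gt; have := ler0n R k; lra. Qed.

Lemma natrS_2lam_gt0 k : 0 < k.+1%:R + 2 * lam.
Proof. by have := lam_gt; have := ler0n R k; lra. Qed.

Lemma size_geg k : size (geg k) = k.+1.
Proof.
elim/nat_ind2: k => [||k size_k size_kS]; first by rewrite geg0 size_poly1.
  by rewrite geg1 size_polyX.
have lead_neq0 : 2 * (k.+1%:R + lam) != 0.
  by rewrite mulf_neq0 ?pnatr_eq0 // lt0r_neq0 ?natrS_lam_gt0.
have size_lead : size ((2 * (k.+1%:R + lam)) *: ('X * geg k.+1)) = k.+3.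
  by rewrite size_scale // mulrC size_mulX ?size_kS // -size_poly_eq0 size_kS.
rewrite -(@size_scale _ k.+2%:R) ?pnatr_eq0 // geg_rec.
rewrite size_polyDl ?size_lead //.
by rewrite size_polyN (leq_ltn_trans (size_scale_leq _ _)) // size_k.
Qed.

End gegenbauer.

(** * Functionals that vanish on weighted derivatives *)

Lemma scalar_sumM (R : comNzRingType) (L : {scalar {poly R}}) (I J : Type)
    (r : seq I) (s : seq J) x y (u : I -> {poly R}) (v : J -> {poly R}) :
  L ((\sum_(i <- r) x i *: u i) * (\sum_(j <- s) y j *: v j)) =
  \sum_(i <- r) \sum_(j <- s) x i * y j * L (u i * v j).
Proof.
rewrite big_distrlr linear_sum; apply: eq_bigr => i _.
rewrite linear_sum; apply: eq_bigr => j _ /=.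
by rewrite -scalerAl -scalerAr !linearZ /= mulrA.
Qed.

Section gegenbauer_functional.
Variables (R : realFieldType) (lam : R) (L : {scalar {poly R}}).
Hypothesis lam_gt : - 2^-1 < lam.
Hypothesis L_weighted_deriv : forall q, L (weighted_deriv lam q) = 0.
Hypothesis L1_gt0 : 0 < L 1.
Implicit Types (p q : {poly R}) (s t : seq nat) (x y : nat -> R).

Local Notation geg := (geg lam).
Local Notation geg_op := (geg_op lam).

(* [linearZ] would also match the products of scalars. *)
Let L0 : L 0 = 0. Proof. exact: linear0. Qed.
Let LZ c p : L (c *: p) = c * L p. Proof. exact: linearZ. Qed.
Let LD p q : L (p + q) = L p + L q. Proof. exact: linearD. Qed.
Let LB p q : L (p - q) = L p - L q. Proof. exact: linearB. Qed.

Lemma geg_op_sym (p q : {poly R}) : L (geg_op p * q) = L (p * geg_op q).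
Proof.
suff dirichlet u v : L (geg_op u * v) = - L ((1 - 'X^2) * (u^`() * v^`())).
  by rewrite [p * _]mulrC !dirichlet [q^`() * _]mulrC.
apply/eqP; rewrite -addr_eq0 -LD; apply/eqP.
rewrite -[RHS](L_weighted_deriv (u^`() * v)); congr (L _).
by rewrite /geg_op /weighted_deriv derivM -!mul_polyC; ring.
Qed.

Lemma geg_orth j k : j != k -> L (geg j * geg k) = 0.
Proof.
move=> jk; have := geg_op_sym (geg j) (geg k).
rewrite !geg_ode // -scalerAl -scalerAr !LZ => /eqP.
rewrite -subr_eq0 -mulrBl mulf_eq0 => /orP[|/eqP //].
rewrite opprK addrC subr_eq0 => /eqP eig_eq.
have : geg_eigenvalue lam k - geg_eigenvalue lam j =
    (k%:R - j%:R) * (k%:R + j%:R + 2 * lam) by rewrite /geg_eigenvalue; ring.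
rewrite eig_eq subrr => /esym/eqP; rewrite mulf_eq0 subr_eq0 eqr_nat.
rewrite eq_sym (negbTE jk) /= -natrD => /eqP lam_eq.
have kj_gt0 : (0 < k + j)%N by case: k j jk {eig_eq lam_eq} => [|k] [|j].
by have := natrS_2lam_gt0 lam_gt (k + j).-1; rewrite prednK // lam_eq ltxx.
Qed.

Definition geg_sqnorm k := L (geg k * geg k).

Definition deriv_gram k l := L ((geg k)^`() * (geg l)^`()).

Lemma form_Xgeg k :
  2 * (k.+1%:R + lam) * L ('X * geg k.+1 * geg k) =
  geg_coef lam k * geg_sqnorm k.
Proof.
have orth : k.+2 != k by rewrite gtn_eqF // leqW.
have recE := congr1 (fun p => L (p * geg k)) (geg_rec lam k).
rewrite /= mulrBl -!scalerAl LB !LZ (geg_orth orth) mulr0 in recE.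
by apply/eqP; rewrite -subr_eq0 -recE.
Qed.

Lemma geg_sqnorm1 : 2 * (1 + lam) * geg_sqnorm 1 = geg_sqnorm 0.
Proof.
by have := form_Xgeg 0; rewrite /geg_sqnorm geg0 geg1 mulr1 /= !mul1r.
Qed.

Lemma geg_sqnormSS k : k.+2%:R * (k.+2%:R + lam) * geg_sqnorm k.+2 =
  (k.+1%:R + lam) * (k.+1%:R + 2 * lam) * geg_sqnorm k.+1.
Proof.
have sqnormE : k.+2%:R * geg_sqnorm k.+2 =
    2 * (k.+1%:R + lam) * L ('X * geg k.+2 * geg k.+1).
  have recE := congr1 (fun p => L (p * geg k.+2)) (geg_rec lam k).
  have orth : k != k.+2 by rewrite ltn_eqF // leqW.
  rewrite /= mulrBl -!scalerAl LB !LZ (geg_orth orth) mulr0 subr0 in recE.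
  by rewrite /geg_sqnorm recE; congr (_ * L _); ring.
have := form_Xgeg k.+1; rewrite [geg_coef _ _]/= => XgegE.
have -> : k.+2%:R * (k.+2%:R + lam) * geg_sqnorm k.+2 =
  (k.+2%:R + lam) * (k.+2%:R * geg_sqnorm k.+2) by ring.
by rewrite sqnormE -[RHS]mulrA -XgegE; ring.
Qed.

Lemma geg_sqnorm_gt0 k : 0 < geg_sqnorm k.
Proof.
have sqnorm0_gt0 : 0 < geg_sqnorm 0 by rewrite /geg_sqnorm geg0 mulr1.
case: k => // k; elim: k => [|k IH].
  have lam1_gt0 : 0 < 1 + lam := natrS_lam_gt0 lam_gt 0.
  by move: sqnorm0_gt0; rewrite -geg_sqnorm1 pmulr_rgt0 ?mulr_gt0.
have : 0 < k.+2%:R * (k.+2%:R + lam) * geg_sqnorm k.+2.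
  by rewrite geg_sqnormSS !mulr_gt0 ?(natrS_lam_gt0 lam_gt)
    ?(natrS_2lam_gt0 lam_gt).
by rewrite pmulr_rgt0 // mulr_gt0 ?(natrS_lam_gt0 lam_gt).
Qed.

Definition geg_comb s x := \sum_(k <- s) x k *: geg k.

Lemma form_geg_comb s x : uniq s ->
  L (geg_comb s x ^+ 2) = diag_form geg_sqnorm s x.
Proof.
move=> s_uniq; rewrite expr2 scalar_sumM; apply: eq_big_seq => i i_s.
rewrite (bigD1_seq i) //= big1 ?addr0 -?expr2 // => j ji.
by rewrite geg_orth ?mulr0 // eq_sym.
Qed.

Lemma form_geg_comb_orth s t x y : (forall i j, i \in s -> j \in t -> i != j) ->
  L (geg_comb s x * geg_comb t y) = 0.
Proof.
move=> st; rewrite scalar_sumM big_seq big1 // => i i_s.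
by rewrite big_seq big1 // => j j_t; rewrite geg_orth ?mulr0 // st.
Qed.

Lemma geg_comb_span n (p : {poly R}) : (size p <= n)%N ->
  exists x, p = geg_comb (index_iota 0 n) x.
Proof. exact: poly_span (size_geg lam_gt) _ _. Qed.

Lemma size_geg_comb n s x : {in s, forall k, (k < n)%N} ->
  (size (geg_comb s x) <= n)%N.
Proof.
move=> s_lt; apply: (leq_trans (size_sum _ _ _)).
apply/bigmax_leqP_seq => k k_s _; apply: (leq_trans (size_scale_leq _ _)).
by rewrite size_geg ?s_lt.
Qed.

Lemma form_sqr_gt0 p : p != 0 -> 0 < L (p ^+ 2).
Proof.
have [x ->] := geg_comb_span (leqnn (size p)); move: (size p) => n.
rewrite form_geg_comb ?iota_uniq //; apply: contraNT.
rewrite -leNgt => diag_le0.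
rewrite /geg_comb big_seq big1 // => k k_lt.
have : diag_form geg_sqnorm (index_iota 0 n) x == 0.
  by rewrite eq_le diag_le0 diag_form_ge0 //; exact: geg_sqnorm_gt0.
rewrite psumr_eq0 => [|i _]; last first.
  by rewrite mulr_ge0 ?sqr_ge0 ?ltW ?geg_sqnorm_gt0.
move=> /allP /(_ k k_lt) /=; rewrite mulf_eq0 sqrf_eq0.
rewrite [geg_sqnorm k == 0]gt_eqF ?geg_sqnorm_gt0 // orbF => /eqP ->.
by rewrite scale0r.
Qed.

Lemma form_sqr_ge0 p : 0 <= L (p ^+ 2).
Proof.
have [->|/form_sqr_gt0/ltW //] := eqVneq p 0.
by rewrite expr2 mulr0 L0.
Qed.

Lemma form_cauchy_schwarz p q : L (p * q) ^+ 2 <= L (p ^+ 2) * L (q ^+ 2).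
Proof.
apply: quadratic_ge0_discr => [|t]; first exact: form_sqr_ge0.
have := form_sqr_ge0 (t *: p + q).
rewrite sqrrD exprZn -scalerAl -scaler_nat scalerA !LD !LZ.
by rewrite mulrC [2 * t * _]mulrAC.
Qed.

Lemma deriv_geg_orth k j : (k <= j)%N || (odd k == odd j) ->
  L ((geg k)^`() * geg j) = 0.
Proof.
elim/nat_ind2: k j => [||k IH _] j; first by rewrite geg0 derivC mul0r L0.
  by rewrite geg1 derivX -(geg0 lam) => j1; apply: geg_orth; case: j j1.
move=> kj; rewrite deriv_gegSS mulrDl -scalerAl LD LZ IH; last first.
  by case/orP: kj => [/ltnW/ltnW -> //|]; rewrite /= negbK => ->; rewrite orbT.
rewrite geg_orth ?mulr0 ?addr0 //.
by apply: contraTneq kj => <-; rewrite ltnn /= negbK -addbT; case: (odd k).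
Qed.

Lemma deriv_gram_same_parity k l : odd k == odd l -> (k <= l)%N ->
  deriv_gram k l = deriv_gram k k.
Proof.
move=> kl_odd kl; have -> : l = (k + (l - k)./2.*2)%N.
  by rewrite even_halfK ?subnKC // oddB // (eqP kl_odd) addbb.
rewrite /deriv_gram; elim: _./2 => [|i IH]; first by rewrite addn0.
rewrite doubleS !addnS deriv_gegSS mulrDr LD IH -scalerAr LZ.
by rewrite deriv_geg_orth ?mulr0 ?addr0 // leqW // leq_addr.
Qed.

Lemma deriv_gram_diff_parity k l : odd k != odd l -> deriv_gram k l = 0.
Proof.
rewrite /deriv_gram; elim/nat_ind2: l => [||l IH _].
- by rewrite geg0 derivC mulr0 L0.
- move=> k_even; rewrite geg1 derivX -(geg0 lam) deriv_geg_orth //.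
  by move: k_even; case: odd; rewrite ?orbT.
rewrite /= negbK => kl; rewrite deriv_gegSS mulrDr LD -scalerAr LZ.
rewrite IH ?deriv_geg_orth ?mulr0 ?addr0 //.
by move: kl => /=; do 2 case: odd; rewrite ?orbT.
Qed.

Lemma deriv_gram_diagSS k : deriv_gram k.+2 k.+2 =
  deriv_gram k k + (2 * (k.+1%:R + lam)) ^+ 2 * geg_sqnorm k.+1.
Proof.
rewrite /deriv_gram deriv_gegSS; move: (2 * _) => c.
have deriv_orth : L ((geg k)^`() * geg k.+1) = 0.
  by rewrite deriv_geg_orth ?leqnSn.
have -> : ((geg k)^`() + c *: geg k.+1) * ((geg k)^`() + c *: geg k.+1) =
    (geg k)^`() * (geg k)^`() + (2 * c) *: ((geg k)^`() * geg k.+1) +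
    c ^+ 2 *: (geg k.+1 * geg k.+1) by rewrite -!mul_polyC; ring.
by rewrite !LD !LZ deriv_orth mulr0 addr0.
Qed.

Lemma geg_sqnormSE k : geg_sqnorm k.+2 =
  (k.+1%:R + lam) * (k.+1%:R + 2 * lam) / (k.+2%:R * (k.+2%:R + lam)) *
  geg_sqnorm k.+1.
Proof.
have lamS_neq0 : k.+2%:R + lam != 0.
  by rewrite lt0r_neq0 ?(natrS_lam_gt0 lam_gt).
have nz : k.+2%:R * (k.+2%:R + lam) != 0 by rewrite mulf_neq0 ?pnatr_eq0.
by apply: (mulfI nz); rewrite geg_sqnormSS mulrA mulrCA divff ?mulr1.
Qed.

Lemma deriv_gram_diag k :
  deriv_gram k k = deriv_ratio lam k%:R * geg_sqnorm k.
Proof.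
have lam_gt' := lam_gt.
have lam1_neq0 : 2 * lam + 1 != 0 by rewrite lt0r_neq0 //; lra.
elim/nat_ind2: k => [||k IH _].
- by rewrite /deriv_gram geg0 derivC mulr0 L0 /deriv_ratio mulr0 !mul0r.
- rewrite /deriv_gram geg1 derivX -(geg0 lam) -/(geg_sqnorm 0) -geg_sqnorm1.
  by rewrite /deriv_ratio; field.
rewrite deriv_gram_diagSS IH; case: k {IH} => [|k].
  rewrite geg_sqnormSE /deriv_ratio; field.
  by rewrite lam1_neq0 lt0r_neq0 //; lra.
rewrite !geg_sqnormSE /deriv_ratio; have := ler0n R k; rewrite -!natr1 => k_ge0.
by field; rewrite lam1_neq0 !lt0r_neq0 //; lra.
Qed.

Lemma sum_deriv_gram_sqr n :
  \sum_(k <- parity_class n) deriv_gram k k ^+ 2 / geg_sqnorm k =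
  deriv_ratio_sum lam n%:R * geg_sqnorm n.
Proof.
have lam_gt' := lam_gt.
have termE k : deriv_gram k k ^+ 2 / geg_sqnorm k =
    deriv_ratio lam k%:R ^+ 2 * geg_sqnorm k.
  by rewrite deriv_gram_diag; field; rewrite lt0r_neq0 ?geg_sqnorm_gt0.
elim/nat_ind2: n => [||n IH _].
- rewrite big_cons big_nil termE addr0 /deriv_ratio_sum /deriv_ratio.
  by rewrite !(mulr0, mul0r) expr0n mul0r.
- rewrite big_cons big_nil termE addr0 /deriv_ratio_sum /deriv_ratio.
  by field; rewrite !lt0r_neq0 //; lra.
rewrite parity_classS big_rcons /= IH termE; case: n {IH} => [|n].
  rewrite geg_sqnormSE /deriv_ratio_sum /deriv_ratio.
  by field; rewrite !lt0r_neq0 //; lra.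
rewrite !geg_sqnormSE /deriv_ratio_sum /deriv_ratio.
have := ler0n R n; rewrite -!natr1 => n_ge0.
by field; rewrite !lt0r_neq0 //; lra.
Qed.

Local Notation class_trace n :=
  (pencil_trace deriv_gram geg_sqnorm (parity_class n)).
Local Notation class_trace_sqr n :=
  (pencil_trace_sqr deriv_gram geg_sqnorm (parity_class n)).

Lemma class_trace_small n : (n < 2)%N -> class_trace n = deriv_ratio lam n%:R.
Proof.
move=> /parity_class_small ->; rewrite /pencil_trace big_seq1 deriv_gram_diag.
by rewrite mulfK ?lt0r_neq0 ?geg_sqnorm_gt0.
Qed.

Lemma class_traceS n :
  class_trace n.+2 = class_trace n + deriv_ratio lam n.+2%:R.
Proof.
rewrite /pencil_trace parity_classS big_rcons /= deriv_gram_diag.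
by rewrite mulfK ?lt0r_neq0 ?geg_sqnorm_gt0.
Qed.

Lemma class_trace_sqr_small n : (n < 2)%N ->
  class_trace_sqr n = trace_sqr_incr lam n%:R.
Proof.
move=> /parity_class_small class_n; have := sum_deriv_gram_sqr n.
have sqnorm_neq0 : geg_sqnorm n != 0 by rewrite lt0r_neq0 ?geg_sqnorm_gt0.
rewrite /pencil_trace_sqr class_n !big_seq1 deriv_gram_diag => sumE.
rewrite /trace_sqr_incr.
have -> : deriv_ratio_sum lam n%:R = deriv_ratio lam n%:R ^+ 2.
  by apply: (mulIf sqnorm_neq0); rewrite -sumE; field.
by field.
Qed.

Lemma class_trace_sqrS n :
  class_trace_sqr n.+2 = class_trace_sqr n + trace_sqr_incr lam n.+2%:R.
Proof.
have sqnorm_neq0 : geg_sqnorm n.+2 != 0 by rewrite lt0r_neq0 ?geg_sqnorm_gt0.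
rewrite parity_classS (pencil_trace_sqr_rcons geg_sqnorm_gt0); last first.
  by move=> i j; rewrite /deriv_gram mulrC.
have -> : \sum_(k <- parity_class n) deriv_gram k n.+2 ^+ 2 / geg_sqnorm k =
    deriv_ratio_sum lam n.+2%:R * geg_sqnorm n.+2 -
    deriv_gram n.+2 n.+2 ^+ 2 / geg_sqnorm n.+2.
  rewrite -sum_deriv_gram_sqr parity_classS big_rcons /= addrK.
  apply: eq_big_seq => k; rewrite mem_parity_class => /andP[kn k_odd].
  by rewrite deriv_gram_same_parity /= ?negbK //; apply/leqW/leqW.
rewrite deriv_gram_diag /trace_sqr_incr -addrA.
by congr (_ + _); field.
Qed.

Lemma class_trace_le n : class_trace n <= trace_bound lam n%:R.
Proof.
have ratio_le k : deriv_ratio lam k <= trace_bound lam k.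
  by rewrite -trace_boundB // gerBl trace_bound_ge0.
elim/nat_ind2: n => [||n IH _].
- by rewrite class_trace_small.
- by rewrite class_trace_small.
rewrite class_traceS -trace_boundB // -[n.+2]addn2 natrD addrK.
by move: IH; lra.
Qed.

Lemma class_trace_sqr_le n : class_trace_sqr n <= markov_upper_sqr lam n%:R.
Proof.
have lam_gt' := lam_gt; have upper_ge0 k : 0 <= markov_upper_sqr lam k.
  by rewrite divr_ge0 ?exprn_even_ge0 ?mulr_ge0 ?sqr_ge0 //; lra.
elim/nat_ind2: n => [||n IH _].
- rewrite class_trace_sqr_small // /trace_sqr_incr.
  by rewrite /deriv_ratio_sum /deriv_ratio !(mulr0, mul0r) expr0n subr0.
- rewrite class_trace_sqr_small // (le_trans (trace_sqr_incr_le lam_gt _)) //.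
  by rewrite gerBl.
rewrite class_trace_sqrS; have nSS_ge1 : 1 <= n.+2%:R :> R by rewrite ler1n.
have := trace_sqr_incr_le lam_gt nSS_ge1.
by rewrite -[n.+2]addn2 natrD addrK; lra.
Qed.

Lemma class_trace_sqr_ge n : (2 <= n)%N ->
  markov_lower lam n%:R * trace_bound lam n%:R <= class_trace_sqr n.
Proof.
elim/nat_ind2: n => // n IH _ _; rewrite class_trace_sqrS.
have [n_le1|n_gt1] := leqP n 1.
  apply: (@le_trans _ _ (trace_sqr_incr lam n.+2%:R)); last first.
    by rewrite lerDr pencil_trace_sqr_ge0 //; exact: geg_sqnorm_gt0.
  apply: markov_lower_base => //.
  by case: n n_le1 {IH} => [|[|]] // _; [left|right].
have nSS_ge2 : 2 <= n.+2%:R :> R by rewrite ler_nat.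
have := markov_lower_step lam_gt nSS_ge2; have := IH n_gt1.
by rewrite -[n.+2]addn2 natrD addrK; lra.
Qed.

Lemma deriv_geg_comb s x :
  (geg_comb s x)^`() = \sum_(k <- s) x k *: (geg k)^`().
Proof. by rewrite raddf_sum; apply: eq_bigr => k _; rewrite /= derivZ. Qed.

Lemma form_deriv_geg_comb s t x y :
  L ((geg_comb s x)^`() * (geg_comb t y)^`()) =
  \sum_(i <- s) \sum_(j <- t) x i * y j * deriv_gram i j.
Proof. by rewrite !deriv_geg_comb scalar_sumM. Qed.

Lemma quad_form_deriv_gram s x :
  quad_form deriv_gram s x = L ((geg_comb s x)^`() ^+ 2).
Proof. by rewrite expr2 form_deriv_geg_comb. Qed.

Lemma deriv_gram_ge0 k : 0 <= deriv_gram k k.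
Proof. by rewrite /deriv_gram -expr2 form_sqr_ge0. Qed.

Lemma deriv_gram_cauchy_schwarz s x j :
  (\sum_(i <- s) x i * deriv_gram i j) ^+ 2 <=
  quad_form deriv_gram s x * deriv_gram j j.
Proof.
have -> : \sum_(i <- s) x i * deriv_gram i j =
    L ((geg_comb s x)^`() * (geg j)^`()).
  rewrite deriv_geg_comb mulr_suml linear_sum; apply: eq_bigr => i _ /=.
  by rewrite -scalerAl LZ.
rewrite quad_form_deriv_gram [deriv_gram _ _]/(L (_ * _)) -expr2.
exact: form_cauchy_schwarz.
Qed.

Lemma form_deriv_class_le n x B : 0 <= B ->
  markov_upper_sqr lam n%:R <= B ^+ 2 ->
  L ((geg_comb (parity_class n) x)^`() ^+ 2) <=
  B * L (geg_comb (parity_class n) x ^+ 2).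
Proof.
move=> B_ge0 upper_le.
rewrite -quad_form_deriv_gram form_geg_comb ?parity_class_uniq //.
apply: quad_form_le => //; first exact: geg_sqnorm_gt0.
exact: le_trans (class_trace_sqr_le n) upper_le.
Qed.

Lemma form_deriv_le n p B : 0 <= B -> (0 < n)%N -> (size p <= n.+1)%N ->
  markov_upper_sqr lam n%:R <= B ^+ 2 -> L (p^`() ^+ 2) <= B * L (p ^+ 2).
Proof.
case: n => // n B_ge0 _ size_p upper_nS; have [x pE] := geg_comb_span size_p.
have upper_n : markov_upper_sqr lam n%:R <= B ^+ 2.
  by rewrite (le_trans _ upper_nS) // le_markov_upper_sqr // ler_nat.
pose p1 := geg_comb (parity_class n.+1) x.
pose p0 := geg_comb (parity_class n) x.
have {pE} -> : p = p1 + p0 by rewrite pE /geg_comb sum_parity_class.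
have diff_parity i j : i \in parity_class n.+1 -> j \in parity_class n ->
    odd i != odd j.
  rewrite !mem_parity_class => /andP[_ /eqP ->] /andP[_ /eqP ->] /=.
  by case: (odd n).
have orth : L (p1 * p0) = 0.
  apply: form_geg_comb_orth => i j i1 j0.
  by apply: contraNneq (diff_parity i j i1 j0) => ->.
have deriv_orth : L (p1^`() * p0^`()) = 0.
  rewrite form_deriv_geg_comb big_seq big1 // => i i1.
  rewrite big_seq big1 // => j j0.
  by rewrite deriv_gram_diff_parity ?mulr0 // diff_parity.
rewrite derivD !sqrrD !mulr2n !LD /= orth deriv_orth !addr0 mulrDr.
by rewrite lerD // form_deriv_class_le.
Qed.

Lemma class_trace_gt0 n : (0 < n)%N -> 0 < class_trace n.
Proof.
move=> n_gt0; have n_ge1 : 1 <= n%:R :> R by rewrite ler1n.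
have lam_gt' := lam_gt; have ratio_gt0 : 0 < deriv_ratio lam n%:R.
  by rewrite divr_gt0 ?mulr_gt0 //; lra.
case: n n_gt0 {n_ge1} ratio_gt0 => [|[|n]] // _ ratio_gt0.
  by rewrite class_trace_small.
rewrite class_traceS ltr_wpDl // sumr_ge0 // => i _.
by rewrite divr_ge0 ?deriv_gram_ge0 // ltW ?geg_sqnorm_gt0.
Qed.

Lemma markov_lower_le n C : (2 <= n)%N -> 0 <= C ->
  (forall p, (size p <= n.+1)%N -> L (p^`() ^+ 2) <= C * L (p ^+ 2)) ->
  markov_lower lam n%:R <= C.
Proof.
move=> n_gt1 C_ge0 bounded; have n_ge2 : 2 <= n%:R :> R by rewrite ler_nat.
have lower_ge0 : 0 <= markov_lower lam n%:R.
  have lam_gt' := lam_gt.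
  by rewrite divr_ge0 ?mulr_ge0 ?sqr_ge0 //; lra.
rewrite -(ler_pM2r (class_trace_gt0 (ltnW n_gt1))).
apply: (@le_trans _ _ (class_trace_sqr n)).
  apply: le_trans (class_trace_sqr_ge n_gt1).
  exact: ler_wpM2l (class_trace_le n).
apply: pencil_trace_sqr_le => //.
- exact: geg_sqnorm_gt0.
- exact: deriv_gram_ge0.
- exact: deriv_gram_cauchy_schwarz.
move=> x; rewrite quad_form_deriv_gram -form_geg_comb ?parity_class_uniq //.
apply/bounded/size_geg_comb => k.
by rewrite mem_parity_class ltnS => /andP[].
Qed.

End gegenbauer_functional.

(** * Integration on an open interval *)

Lemma cvg_at_right_near (T : Type) (R : numFieldType) (F : set_system T)
    {FF : Filter F} (f : T -> R) (l : R) :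
  f @ F --> l -> (\forall x \near F, l < f x) -> f @ F --> l^'+.
Proof.
by move=> fl f_gt A /fl fA; near=> x; apply: (near fA x) => //; near: x.
Unshelve. all: by end_near.
Qed.

Lemma Rintegral_gt0 d (T : measurableType d) (R : realType)
    (mu : {measure set T -> \bar R}) (D : set T) (f : T -> R) :
  measurable D -> (0 < mu D)%E -> mu.-integrable D (EFin \o f) ->
  (forall x, D x -> 0 < f x) -> 0 < Rintegral mu D f.
Proof.
move=> mD muD_gt0 f_int f_gt0; rewrite lt0r Rintegral_ge0 ?andbT; last first.
  by move=> x /f_gt0/ltW.
apply: contraPneq muD_gt0 => int0.
have [mf _] := integrableP _ _ _ f_int.
have : (\int[mu]_(x in D) `|(EFin \o f) x| = 0)%E.
  have -> : (\int[mu]_(x in D) `|(EFin \o f) x| =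
      \int[mu]_(x in D) (f x)%:E)%E.
    apply: eq_integral => x /set_mem Dx.
    by rewrite gee0_abs // lee_fin ltW // f_gt0.
  rewrite -[LHS]fineK ?integrable_fin_num //.
  by rewrite -[fine _]/(Rintegral mu D f) int0.
move/(ae_eq_integral_abs mu mD mf) => -[N [mN N0 sub]].
apply/negP; rewrite -leNgt -N0 le_measure ?inE // => x Dx; apply: sub => /= f0.
by have := f_gt0 x Dx; have [->] := f0 Dx; rewrite ltxx.
Qed.

Lemma integrable_itvoo_itvcc (R : realType) (f : R -> R) a b :
  lebesgue_measure.-integrable `]a, b[ (EFin \o f) ->
  lebesgue_measure.-integrable `[a, b] (EFin \o f).
Proof.
move=> /integrableP[mf_oo fin_oo].
have mf_oc : measurable_fun `]a, b] (EFin \o f).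
  exact/emeasurable_fun_itv_bndo_bndcP.
apply/integrableP; split; first exact/emeasurable_fun_itv_obnd_cbndP.
rewrite -integral_itv_obnd_cbnd; last exact: measurableT_comp.
by rewrite -integral_itv_bndo_bndc //; exact: measurableT_comp.
Qed.

Lemma itvoo_bigcup_itvcc (R : realType) (a b : R) :
  `]a, b[%classic = \bigcup_k `[a + k.+1%:R^-1, b - k.+1%:R^-1]%classic.
Proof.
apply/seteqP; split=> [x /=|x [k _] /=]; rewrite !in_itv /=; last first.
  move=> /andP[ax xb]; rewrite (lt_le_trans _ ax) ?ltrDl ?invr_gt0 //=.
  by rewrite (le_lt_trans xb) // gtrBl invr_gt0.
move=> /andP[ax xb]; have m_gt0 : 0 < Num.min (x - a) (b - x).
  by rewrite lt_min !subr_gt0 ax.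
have [k _ /(_ k (leqnn k))] := near_infty_natSinv_lt (PosNum m_gt0).
rewrite /= lt_min ltrBrDl ltrBrDr => /andP[ka kb]; exists k => //=.
by rewrite in_itv /= ltW //= lerBrDl ltW // addrC.
Qed.

Section open_interval_FTC.
Context (R : realType).
Notation mu := (@lebesgue_measure R).
Variables (f F : R -> R) (a b : R).
Hypothesis f_continuous : {in `]a, b[, continuous f}.
Hypothesis F_derive : {in `]a, b[, forall x : R, is_derive x 1 F (f x)}.

Lemma integral_segment_FTC2 c d : a < c -> c <= d -> d < b ->
  (\int[mu]_(x in `[c, d]) (f x)%:E = (F d - F c)%:E)%E.
Proof.
move=> ac; rewrite le_eqVlt => /predU1P[-> db|cd db].
  by rewrite set_itv1 integral_set1 subrr.
have sub : {subset `[c, d] <= `]a, b[}.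
  move=> x; rewrite !in_itv /= => /andP[/(lt_le_trans ac) ->].
  by move=> /le_lt_trans ->.
have F_cont : {within `[c, d], continuous F}.
  apply: derivable_within_continuous => x /sub/F_derive ?; exact: ex_derive.
have [F_in F_c F_d] := (continuous_within_itvP F cd).1 F_cont.
rewrite EFinB; apply: continuous_FTC2 => //.
- apply: continuous_in_subspaceT => x /set_mem /= /sub; exact: f_continuous.
- split=> // x /subset_itv_oo_cc/sub/F_derive ?; exact: ex_derive.
- by move=> x /subset_itv_oo_cc/sub/F_derive Fx; rewrite derive1E derive_val.
Qed.

Lemma parameterized_integralB c d : mu.-integrable `[a, b] (EFin \o f) ->
  a < c -> c <= d -> d < b ->
  parameterized_integral mu a d f - parameterized_integral mu a c f = F d - F c.
Proof.
move=> f_int ac cd db; have f_int_ad : mu.-integrable `[a, d] (EFin \o f).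
  by apply: integrableS f_int => //; apply: subset_itvl; rewrite bnd_simp ltW.
have f_int_cd : mu.-integrable `]c, d] (EFin \o f).
  apply: integrableS f_int_ad => //; apply: subset_itvr.
  by rewrite bnd_simp ltW.
rewrite /parameterized_integral Rintegral_itvB ?bnd_simp //; last exact: ltW.
by rewrite Rintegral_itv_obnd_cbnd // /Rintegral integral_segment_FTC2.
Qed.

Lemma Rintegral_itvoo_FTC2 (la lb : R) : a < b ->
  mu.-integrable `]a, b[ (EFin \o f) ->
  F x @[x --> a^'+] --> la -> F x @[x --> b^'-] --> lb ->
  Rintegral mu `]a, b[ f = lb - la.
Proof.
move=> ab /[dup] f_int_oo /integrable_itvoo_itvcc f_int F_a F_b.
pose I x := parameterized_integral mu a x f.
have I_a : I x @[x --> a^'+] --> (0 : R).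
  exact/cvg_at_right_filter/(parameterized_integral_cvg_left ab f_int).
have I_b : I x @[x --> b^'-] --> I b.
  exact: (parameterized_integral_cvg_at_left ab f_int).
have const c : a < c -> c < b -> I b - lb = I c - F c.
  move=> ac cb; apply: (cvg_unique _ (cvgB I_b F_b)) => //.
  apply: cvg_near_cst; near=> x.
  have cx : c <= x by near: x; exact: nbhs_left_ge.
  have xb : x < b by near: x; exact: nbhs_left_lt.
  have IF_const : I x - F x = I c - F c.
    have := parameterized_integralB f_int ac cx xb.
    by rewrite -/(I x) -/(I c); lra.
  exact: IF_const.
suff -> : Rintegral mu `]a, b[ f = I b.
  have : I b - lb = 0 - la.
    apply: (cvg_unique _ _ (cvgB I_a F_a)) => //.
    apply: cvg_near_cst; near=> x.
    have ax : a < x by near: x; exact: nbhs_right_gt.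
    have xb : x < b by near: x; exact: nbhs_right_lt.
    by rewrite (const x).
  lra.
rewrite Rintegral_itv_bndo_bndc // Rintegral_itv_obnd_cbnd //.
by apply: integrableS f_int => //; exact: subset_itv_oc_cc.
Unshelve. all: by end_near.
Qed.

Lemma integrable_ge0_bounded_primitive M : {in `]a, b[, forall x, 0 <= f x} ->
  {in `]a, b[, forall x, `|F x| <= M} -> mu.-integrable `]a, b[ (EFin \o f).
Proof.
move=> f_ge0 F_le; have [ab|ba] := ltP a b; last first.
  rewrite set_itv_ge ?bnd_simp -?leNgt //; exact: integrable_set0.
have mf : measurable_fun `]a, b[ (EFin \o f).
  apply/measurable_EFinP; apply: open_continuous_measurable_fun => //.
  by move=> x /set_mem /=; exact: f_continuous.
apply/integrableP; split=> //.
have -> : (\int[mu]_(x in `]a, b[) `|(EFin \o f) x| =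
    \int[mu]_(x in `]a, b[) (f x)%:E)%E.
  by apply: eq_integral => x /set_mem xab; rewrite gee0_abs // lee_fin f_ge0.
apply: (@le_lt_trans _ _ (2 * M)%:E); last exact: ltry.
have sub k : `[a + k.+1%:R^-1, b - k.+1%:R^-1] `<=` `]a, b[.
  by rewrite itvoo_bigcup_itvcc => x xk; exists k.
rewrite itvoo_bigcup_itvcc.
apply: (cvge_le _ (@ge0_nondecreasing_set_cvg_integral _ _ _ _ _ _ _ _ _ _)).
- apply: nearW => k; have [cd|dc] := leP (a + k.+1%:R^-1) (b - k.+1%:R^-1).
    have ac : a < a + k.+1%:R^-1 by rewrite ltrDl invr_gt0.
    have db : b - k.+1%:R^-1 < b by rewrite gtrBl invr_gt0.
    rewrite integral_segment_FTC2 // lee_fin (le_trans (ler_norm _)) //.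
    rewrite (le_trans (ler_normB _ _)) // mulr2n mulrDl mul1r.
    by rewrite lerD // F_le // in_itv /= ?(lt_le_trans ac) ?(le_lt_trans cd)
      ?ac ?db.
  rewrite set_itv_ge ?bnd_simp -?ltNge // integral_set0 lee_fin mulr_ge0 //.
  by rewrite (le_trans _ (F_le ((a + b) / 2) _)) // in_itv /= !midf_lt.
- move=> m n mn; rewrite subsetEset; apply: subset_itv; rewrite bnd_simp.
    by rewrite lerD2l lef_pV2 ?posrE // ler_nat ltnS.
  by rewrite lerD2l lerN2 lef_pV2 ?posrE // ler_nat ltnS.
- by move=> k; exact: measurable_itv.
- by move=> k; apply: measurable_funS mf.
- move=> k x /sub /=; rewrite lee_fin; exact: f_ge0.
Qed.

End open_interval_FTC.

(** * The Gegenbauer weight *)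

Section gegenbauer_weight.
Context (R : realType).
Notation mu := (@lebesgue_measure R).
Implicit Types (lam t : R) (p q : {poly R}).

Lemma onem_sqr_gt0 t : t \in `]-1, 1[ -> 0 < 1 - t ^+ 2.
Proof. by rewrite in_itv /= => /andP[? ?]; nra. Qed.

Lemma gweight_ge0 lam t : 0 <= gweight lam t.
Proof. exact: powR_ge0. Qed.

Lemma gweight_gt0 lam t : t \in `]-1, 1[ -> 0 < gweight lam t.
Proof. by move=> /onem_sqr_gt0; exact: powR_gt0. Qed.

Lemma gweight_le1 lam t : 2^-1 <= lam -> t \in `]-1, 1[ -> gweight lam t <= 1.
Proof.
move=> lam_ge t_itv; have t01 : 0 < 1 - t ^+ 2 <= 1.
  by rewrite onem_sqr_gt0 //= gerBl sqr_ge0.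
by rewrite -[leRHS](powRr0 (1 - t ^+ 2)) ger_powR // subr_ge0.
Qed.

Lemma gweightS lam t : t \in `]-1, 1[ ->
  gweight (lam + 1) t = (1 - t ^+ 2) * gweight lam t.
Proof.
move=> /onem_sqr_gt0 t_itv; rewrite /gweight -{2}(powRr1 (ltW t_itv)) -powRD.
  by congr (_ `^ _); ring.
by rewrite (gt_eqF t_itv) implybT.
Qed.

Lemma is_derive_gweightS lam t : t \in `]-1, 1[ ->
  is_derive t 1 (gweight (lam + 1)) (- (2 * lam + 1) * t * gweight lam t).
Proof.
move=> /onem_sqr_gt0 t_itv.
have d_onem : is_derive t 1 (fun x : R => 1 - x ^+ 2) (- (2 * t)).
  by apply: is_derive_eq; rewrite /= /GRing.scale /=; ring.
have d_powR := is_derive1_powR (lam + 1 - 2^-1) t_itv.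
have d_gweight : is_derive t 1 (gweight (lam + 1)) _ :=
  @is_derive1_comp R (@powR R ^~ _) (fun x => 1 - x ^+ 2) t _ _ d_powR d_onem.
have exponentE : lam + 1 - 2^-1 - 1 = lam - 2^-1 by ring.
apply: is_derive_eq; rewrite /gweight exponentE.
by set w := _ `^ _; field.
Qed.

Lemma derivable_gweight lam t : t \in `]-1, 1[ -> derivable (gweight lam) t 1.
Proof.
move=> t_itv; rewrite -(subrK 1 lam).
by have d_gweight := is_derive_gweightS (lam - 1) t_itv; exact: ex_derive.
Qed.

Lemma measurable_gweight lam D : measurable_fun D (gweight lam).
Proof.
apply: measurable_funTS; apply: (measurableT_comp (measurable_powR _)).
by apply: measurable_funB => //; exact: measurable_funX.
Qed.

Lemma gweight_cvg0 lam (F : set_system R) {FF : Filter F} : 2^-1 < lam ->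
  (\forall t \near F, t \in `]-1, 1[) -> 1 - t ^+ 2 @[t --> F] --> 0 ->
  gweight lam @ F --> 0.
Proof.
move=> lam_gt F_itv onem_cvg; have exp_gt0 : 0 < lam - 2^-1 by rewrite subr_gt0.
have onem_cvg_right : 1 - t ^+ 2 @[t --> F] --> 0^'+.
  apply: (cvg_at_right_near onem_cvg).
  by apply: filterS F_itv => t /onem_sqr_gt0.
exact: (@cvg_comp _ _ _ (fun t => 1 - t ^+ 2) (@powR R ^~ _) _ _ _
  onem_cvg_right (powR_cvg0 exp_gt0)).
Qed.

Lemma onem_sqr_cvg0 (a : R) : a ^+ 2 = 1 -> 1 - t ^+ 2 @[t --> a] --> 0.
Proof.
move=> a_sqr; rewrite [X in _ --> X](_ : _ = 1 - a ^+ 2); last first.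
  by rewrite a_sqr subrr.
by apply: cvgB; [exact: cvg_cst | exact: exprn_continuous].
Qed.

Lemma gweight_cvg_at_left lam : 2^-1 < lam ->
  gweight lam t @[t --> 1^'-] --> 0.
Proof.
move=> lam_gt; apply: gweight_cvg0 => //; last first.
  by apply/cvg_at_left_filter/onem_sqr_cvg0; rewrite expr1n.
near=> t; rewrite in_itv /=; apply/andP; split.
  by near: t; apply: nbhs_left_gt; lra.
by near: t; exact: nbhs_left_lt.
Unshelve. all: by end_near.
Qed.

Lemma gweight_cvg_at_right lam : 2^-1 < lam ->
  gweight lam t @[t --> (-1)^'+] --> 0.
Proof.
move=> lam_gt; apply: gweight_cvg0 => //; last first.
  by apply/cvg_at_right_filter/onem_sqr_cvg0; rewrite sqrrN expr1n.
near=> t; rewrite in_itv /=; apply/andP; split.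
  by near: t; exact: nbhs_right_gt.
by near: t; apply: nbhs_right_lt; lra.
Unshelve. all: by end_near.
Qed.

Lemma is_derive_gweightM lam q t : t \in `]-1, 1[ ->
  is_derive t 1 (fun x => gweight (lam + 1) x * q.[x])
    (gweight lam t * (weighted_deriv lam q).[t]).
Proof.
move=> t_itv; have d_weight := is_derive_gweightS lam t_itv.
have d_q : is_derive t 1 (horner q) q^`().[t].
  by rewrite derivE derive1E; apply/derivableP/derivable_horner.
have d_M := is_deriveM d_weight d_q.
by apply: is_derive_eq; rewrite !hornerE gweightS // /GRing.scale /=; ring.
Qed.

Lemma continuous_gweightM lam q :
  {in `]-1, 1[, continuous (fun t => gweight lam t * q.[t])}.
Proof.
move=> t t_itv; apply: continuousM; last exact: continuous_horner.
exact/differentiable_continuous/derivable1_diffP/derivable_gweight.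
Qed.

(* The right-hand side is the derivative of the bounded function
   [(2 lam + 2) t - t w_(lam + 1) t], so this bound makes [w_lam] integrable. *)
Lemma gweight_le_deriv lam t : - 2^-1 < lam -> t \in `]-1, 1[ ->
  (2 * lam + 1) * gweight lam t <=
  2 * lam + 2 - gweight lam t * (weighted_deriv lam 'X).[t].
Proof.
move=> lam_gt t_itv; have : gweight (lam + 1) t <= 1.
  by apply: gweight_le1 => //; lra.
rewrite gweightS // /weighted_deriv !hornerE derivX !hornerE /=.
move: (gweight lam t) => w w_le.
have : 0 <= (2 * lam + 2) * (1 - (1 - t ^+ 2) * w) by apply: mulr_ge0; lra.
lra.
Qed.

Lemma integrable_gweight lam : - 2^-1 < lam ->
  mu.-integrable `]-1, 1[ (EFin \o gweight lam).
Proof.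
move=> lam_gt; have lam1_gt0 : 0 < 2 * lam + 1 by lra.
pose f t := 2 * lam + 2 - gweight lam t * (weighted_deriv lam 'X).[t].
pose F t := (2 * lam + 2) * t - gweight (lam + 1) t * 'X.[t].
have f_ge0 t : t \in `]-1, 1[ -> 0 <= f t.
  move=> t_itv; apply: le_trans (gweight_le_deriv lam_gt t_itv).
  by rewrite mulr_ge0 ?gweight_ge0 // ltW.
have F_le t : t \in `]-1, 1[ -> `|F t| <= 2 * lam + 3.
  move=> t_itv; have weight_le1 : `|gweight (lam + 1) t| <= 1.
    by rewrite ger0_norm ?gweight_ge0 // gweight_le1 //; lra.
  have t_le1 : `|t| <= 1.
    by move: t_itv; rewrite in_itv /= ler_norml => /andP[/ltW -> /ltW].
  rewrite /F hornerX -mulrBl normrM -[leRHS]mulr1 ler_pM //.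
  rewrite (le_trans (ler_normB _ _)) // ger0_norm; lra.
have f_int : mu.-integrable `]-1, 1[ (EFin \o f).
  apply: (@integrable_ge0_bounded_primitive R f F _ _ _ _ _ f_ge0 F_le).
    move=> t t_itv.
    by apply: cvgB; [exact: cvg_cst | exact: continuous_gweightM].
  move=> t t_itv; have d_weight := is_derive_gweightM lam 'X t_itv.
  have d_lin : is_derive t 1 (fun x : R => (2 * lam + 2) * x) (2 * lam + 2).
    by apply: is_derive_eq; rewrite /GRing.scale /= mulr1.
  exact: is_deriveB.
pose bound := EFin \o (fun t => (2 * lam + 1)^-1 * f t).
apply: (@le_integrable _ _ _ mu _ _ _ bound) => //.
- by apply/measurable_EFinP; exact: measurable_gweight.
- move=> t /= t_itv; rewrite lee_fin ger0_norm ?gweight_ge0 //.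
  rewrite (le_trans _ (ler_norm _)) // ler_pdivlMl //.
  exact: gweight_le_deriv.
- exact: (integrableZl _ _ f_int).
Qed.

Lemma integrable_gweightM lam p : - 2^-1 < lam ->
  mu.-integrable `]-1, 1[ (EFin \o (fun t => gweight lam t * p.[t])).
Proof.
move=> lam_gt; pose M := \sum_(i < size p) `|p`_i|.
pose bound := EFin \o (fun t => M * gweight lam t).
apply: (@le_integrable _ _ _ mu _ _ _ bound) => //.
- apply/measurable_EFinP/measurable_funM; first exact: measurable_gweight.
  exact: measurable_funTS (continuous_measurable_fun (@continuous_horner R p)).
- move=> t t_itv; have M_ge0 : 0 <= M by exact: sumr_ge0.
  rewrite lee_fin !normrM mulrC ler_wpM2r // (ger0_norm M_ge0) horner_coef.
  apply: (le_trans (ler_norm_sum _ _ _)); apply: ler_sum => i _.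
  rewrite normrM normrX ler_piMr // exprn_ile1 // ler_norml.
  by move: t_itv; rewrite /= in_itv /= => /andP[/ltW -> /ltW ->].
- exact: (integrableZl _ _ (integrable_gweight lam_gt)).
Qed.

End gegenbauer_weight.

(** * The Markov constant *)

Section gegenbauer_integral.
Context (R : realType).
Notation mu := (@lebesgue_measure R).
Variable lam : R.
Hypothesis lam_gt : - 2^-1 < lam.

Definition gint_fun (p : {poly R}) : R :=
  Rintegral mu `]-1, 1[ (fun t => gweight lam t * p.[t]).

Lemma gint_fun_linear : linear_for *%R gint_fun.
Proof.
move=> c p q; have p_int := integrable_gweightM p lam_gt.
rewrite /gint_fun -RintegralZl // -RintegralD //; first last.
- exact: integrable_gweightM.
- exact: (integrableZl _ _ p_int).
by apply: eq_Rintegral => t _; rewrite !hornerE /=; ring.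
Qed.

HB.instance Definition _ :=
  GRing.isLinear.Build R {poly R} R *%R gint_fun gint_fun_linear.

Definition gint : {scalar {poly R}} := gint_fun.

Lemma gint_weighted_deriv (q : {poly R}) : gint (weighted_deriv lam q) = 0.
Proof.
have weight_gt : 2^-1 < lam + 1 by have := lam_gt; lra.
have q_cvg (a : R) : q.[t] @[t --> a] --> q.[a] by exact: continuous_horner.
rewrite [LHS](@Rintegral_itvoo_FTC2 R _ (fun t => gweight (lam + 1) t * q.[t])
  (-1) 1 _ _ 0 0) ?subrr //.
- exact: continuous_gweightM.
- by move=> t; exact: is_derive_gweightM.
- exact: integrable_gweightM.
- rewrite -(mul0r q.[-1]); apply: cvgM; first exact: gweight_cvg_at_right.
  exact/cvg_at_right_filter/q_cvg.
- rewrite -(mul0r q.[1]); apply: cvgM; first exact: gweight_cvg_at_left.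
  exact/cvg_at_left_filter/q_cvg.
Qed.

Lemma gint1_gt0 : 0 < gint 1.
Proof.
apply: Rintegral_gt0 => //.
- by rewrite /= lebesgue_measure_itv /= lte_fin gtrN // -EFinD lte_fin; lra.
- exact: (integrable_gweightM 1).
- by move=> t t_itv; rewrite hornerC mulr1 gweight_gt0.
Qed.

Lemma gnorm_horner (p : {poly R}) :
  Defs.gnorm lam (fun t => p.[t]) = Num.sqrt (gint (p ^+ 2)).
Proof. by congr Num.sqrt; apply: eq_Rintegral => t _; rewrite horner_exp. Qed.

Lemma gint_sqr_gt0 (p : {poly R}) : p != 0 -> 0 < gint (p ^+ 2).
Proof. exact: (form_sqr_gt0 lam_gt gint_weighted_deriv gint1_gt0). Qed.

Lemma gnorm_ratio_le (p : {poly R}) (r : R) : 0 <= r -> p != 0 ->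
  (Defs.gnorm lam (fun t => p^`().[t]) / Defs.gnorm lam (fun t => p.[t]) <= r) =
  (gint (p^`() ^+ 2) <= r ^+ 2 * gint (p ^+ 2)).
Proof.
move=> r_ge0 /gint_sqr_gt0 p_gt0.
rewrite !gnorm_horner ler_pdivrMr ?sqrtr_gt0 //.
rewrite -{1}(ger0_norm r_ge0) -sqrtr_sqr -sqrtrM ?sqr_ge0 // ler_sqrt //.
by rewrite mulr_ge0 ?sqr_ge0 // ltW.
Qed.

Lemma markov_const_leP n (r : R) : 0 <= r ->
  (markov_const n lam <= r%:E)%E <->
  (forall p : {poly R}, (size p <= n.+1)%N ->
     gint (p^`() ^+ 2) <= r ^+ 2 * gint (p ^+ 2)).
Proof.
move=> r_ge0; split=> [markov_le p size_p|bounded].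
  have [->|p_neq0] := eqVneq p 0; first by rewrite deriv0 expr0n linear0 mulr0.
  rewrite -gnorm_ratio_le // -lee_fin (le_trans _ markov_le) //.
  by apply: ereal_sup_ubound; exists p.
apply: ge_ereal_sup => _ [p [size_p p_neq0] <-].
by rewrite lee_fin gnorm_ratio_le // bounded.
Qed.

Lemma markov_const_ge0 n : (0 <= markov_const n lam)%E.
Proof.
apply: ereal_sup_ubound; exists 1.
  by split; rewrite /polys_le /= ?size_poly1 ?oner_neq0.
by rewrite gnorm_horner derivC expr0n linear0 sqrtr0 mul0r.
Qed.

Lemma le_markov_const_sqr n : (2 <= n)%N ->
  ((markov_lower lam n%:R)%:E <= markov_const n lam * markov_const n lam)%E.
Proof.
move=> n_gt1; have := markov_const_ge0 n.
case markovE: (markov_const n lam) => [r||] //; last first.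
  by move=> _; rewrite mulyy leey.
rewrite lee_fin => r_ge0; rewrite -EFinM lee_fin -expr2.
apply: (markov_lower_le lam_gt gint_weighted_deriv gint1_gt0 n_gt1 (sqr_ge0 r)).
by apply/markov_const_leP => //; rewrite markovE.
Qed.

Lemma markov_const_sqr_le n (B : R) : (0 < n)%N -> 0 <= B ->
  markov_upper_sqr lam n%:R <= B ^+ 2 ->
  (markov_const n lam * markov_const n lam <= B%:E)%E.
Proof.
move=> n_gt0 B_ge0 upper_le; rewrite -(sqr_sqrtr B_ge0) expr2 EFinM.
suff markov_le : (markov_const n lam <= (Num.sqrt B)%:E)%E.
  by apply: lee_pmul => //; exact: markov_const_ge0.
apply/markov_const_leP => // p size_p; rewrite sqr_sqrtr //.
exact: (form_deriv_le lam_gt gint_weighted_deriv gint1_gt0 B_ge0 n_gt0 size_p).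
Qed.

End gegenbauer_integral.

Theorem theorem1p1 (R : realType) (n : nat) (lam : R)
  (hn : (3 <= n)%N) (hlam : - 2^-1 < lam) :
  ((((n.+1)%:R * (n%:R + lam + 2^-1) ^+ 2 * (n%:R + 2 * lam))
      / ((2 * lam + 1) * (2 * lam + 5)))%:E
     <= markov_const n lam * markov_const n lam)%E /\
  (markov_const n lam * markov_const n lam
     <= ((n%:R + 5 / 4 * lam + 9 / 8) ^+ 4
          / (2 * (2 * lam + 1) * Num.sqrt (2 * lam + 5)))%:E)%E.
Proof.
split.
  rewrite -natr1 -/(markov_lower_num lam n%:R) -/(markov_lower lam n%:R).
  exact/le_markov_const_sqr/ltnW.
have lam1_gt0 : 0 < 2 * lam + 1 by lra.
have n_ge3 : 3 <= n%:R :> R by rewrite ler_nat.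
apply: markov_const_sqr_le => //; first exact: ltn_trans hn.
  by rewrite divr_ge0 ?exprn_ge0 ?mulr_ge0 ?sqrtr_ge0 //; lra.
rewrite expr_div_n -exprM !exprMn sqr_sqrtr; last by lra.
by rewrite /markov_upper_sqr -natrX.
Qed.
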